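(* Let $X$ be the generic symmetric $n\times n$ matrix. Then the apolar ideal $\mathrm{Ann}(\mathrm{perm}(X))\subset S$ equals the ideal $(Q')^+$ described in the context, which is generated by forms of degrees two and three.
   Context: Let $\mathsf k$ be an infinite field of characteristic zero or characteristic $p>2$. $X=(x_{ij})$ is the generic symmetric $n\times n$ matrix: its entries $x_{ij}=x_{ji}$, $1\le i\le j\le n$, are $n(n+1)/2$ distinct variables. $R=\mathsf k[x_{ij}: i\le j]$ and $S=\mathsf k[y_{ij}: i\le j]$, with the convention $y_{ij}=y_{ji}$. $S$ acts on $R$ by differentiation: $y_{ij}$ acts as $\partial/\partial x_{ij}$, and the action of $h\in S$ on $F\in R$ is written $h\circ F$. For $F\in R$, $\mathrm{Ann}(F)=\{h\in S: h\circ F=0\}$. $\mathrm{perm}(X)$ is the permanent of $X$. $Q'\subset S_2$ is the set consisting of: (a) the monomials $y_{ii}y_{ij}$ for all $1\le i,j\le n$ ($i=j$ allowed); (b) the binomials $y_{ij}^2-2y_{ii}y_{jj}$ for $i\ne j$; (c) the binomials $y_{ji}y_{il}-y_{jl}y_{ii}$ for $i,j,l$ pairwise distinct. For each $1\le i_1<\dots<i_6\le n$ put $z_{ab}=y_{i_ai_b}$ and define the cubic forms $F_1=z_{15}z_{24}z_{36}-z_{14}z_{25}z_{36}-z_{15}z_{23}z_{46}+z_{13}z_{25}z_{46}+z_{14}z_{23}z_{56}-z_{13}z_{24}z_{56}$, $F_2=z_{14}z_{26}z_{35}-z_{14}z_{25}z_{36}-z_{13}z_{26}z_{45}+z_{12}z_{36}z_{45}+z_{13}z_{25}z_{46}-z_{12}z_{35}z_{46}$,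 $F_3=z_{16}z_{24}z_{35}-z_{14}z_{25}z_{36}-z_{16}z_{23}z_{45}+z_{12}z_{36}z_{45}+z_{13}z_{25}z_{46}-z_{12}z_{35}z_{46}+z_{14}z_{23}z_{56}-z_{13}z_{24}z_{56}$, $F_4=z_{15}z_{26}z_{34}-z_{14}z_{25}z_{36}-z_{13}z_{26}z_{45}+z_{12}z_{36}z_{45}-z_{15}z_{23}z_{46}+z_{13}z_{25}z_{46}+z_{14}z_{23}z_{56}-z_{12}z_{34}z_{56}$, $F_5=z_{16}z_{25}z_{34}-z_{14}z_{25}z_{36}-z_{16}z_{23}z_{45}+z_{12}z_{36}z_{45}+z_{14}z_{23}z_{56}-z_{12}z_{34}z_{56}$. Let $H$ be the ideal generated by all these cubics, over all choices of $i_1<\dots<i_6$ ($H=0$ if $n<6$), and let $(Q')^+=(Q')+H$. *)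

(* Defs.v *)
From HB Require Import structures.
From mathcomp Require Import all_boot all_order all_algebra all_fingroup.
From mathcomp Require Import mpoly.

Set Implicit Arguments.
Unset Strict Implicit.
Unset Printing Implicit Defensive.

Import GRing.Theory.
Local Open Scope ring_scope.

Definition infinite_field (k : fieldType) : Prop :=
  forall s : seq k, exists x : k, x \notin s.

Definition char_zero_or_gt2 (k : fieldType) : Prop :=
  [pchar k] =i pred0 \/ exists2 p : nat, p \in [pchar k] & (2 < p)%N.

(* Positions (i, j) with i <= j: they index the n(n+1)/2 distinct entries of
   the generic symmetric n x n matrix. *)
Definition sympos (n : nat) : predArgType :=
  {p : 'I_n * 'I_n | (p.1 <= p.2)%N}.

Definition nsym (n : nat) : nat := #|{: sympos n}|.

Definition sort_pair (n : nat) (i j : 'I_n) : 'I_n * 'I_n :=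
  if (i <= j)%N then (i, j) else (j, i).

Lemma sort_pair_le (n : nat) (i j : 'I_n) :
  ((sort_pair i j).1 <= (sort_pair i j).2)%N.
Proof. by rewrite /sort_pair; case: (leqP i j) => [|/ltnW]. Qed.

(* The number of the variable of index {i, j}, so that x_ij = x_ji. *)
Definition symidx (n : nat) (i j : 'I_n) : 'I_(nsym n) :=
  enum_rank (exist _ (sort_pair i j) (sort_pair_le i j) : sympos n).

Lemma symidxC (n : nat) (i j : 'I_n) : symidx i j = symidx j i.
Proof.
congr enum_rank; apply: val_inj; rewrite /= /sort_pair.
by case: (ltngtP i j) => // /val_inj ->.
Qed.

Lemma symidx_inj (n : nat) (i j i' j' : 'I_n) :
  (i <= j)%N -> (i' <= j')%N -> symidx i j = symidx i' j' ->
  i = i' /\ j = j'.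
Proof.
move=> le_ij le_ij' /enum_rank_inj/(congr1 val).
by rewrite /= /sort_pair le_ij le_ij' => -[-> ->].
Qed.

(* R = k[x_ij] and S = k[y_ij] are two copies of the same polynomial ring;
   S acts on R by [apply_diff]. *)
Definition polyR (n : nat) (k : fieldType) := {mpoly k[nsym n]}.
Definition polyS (n : nat) (k : fieldType) := {mpoly k[nsym n]}.

Definition apply_diff (n : nat) (k : fieldType) (h : polyS n k)
    (F : polyR n k) : polyR n k :=
  \sum_(m <- msupp h) h@_m *: mderivm m F.

Definition Ann (n : nat) (k : fieldType) (F : polyR n k) (h : polyS n k) :
  Prop := apply_diff h F = 0.

Definition permanent (A : comNzRingType) (n : nat) (M : 'M[A]_n) : A :=
  \sum_(s : 'S_n) \prod_(i < n) M i (s i).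

Definition generic_sym (n : nat) (k : fieldType) :
    'M[{mpoly k[nsym n]}]_n := \matrix_(i, j) 'X_(symidx i j).

Definition yvar (n : nat) (k : fieldType) (i j : 'I_n) : {mpoly k[nsym n]} :=
  'X_(symidx i j).

Definition ideal_gen (A : comNzRingType) (G : A -> Prop) (h : A) : Prop :=
  exists2 s : seq (A * A),
    (forall u, u \in s -> G u.2) & h = \sum_(u <- s) u.1 * u.2.

Definition ideal_add (A : comNzRingType) (I J : A -> Prop) (h : A) : Prop :=
  exists f g : A, [/\ I f, J g & h = f + g].

Section Generators.

Variables (n : nat) (k : fieldType).

Local Notation y := (@yvar n k).

Inductive Qprime : {mpoly k[nsym n]} -> Prop :=
| Qprime_a (i j : 'I_n) : Qprime (y i i * y i j)
| Qprime_b (i j : 'I_n) : i != j ->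
    Qprime (y i j ^+ 2 - 2%:R * (y i i * y j j))
| Qprime_c (i j l : 'I_n) : i != j -> i != l -> j != l ->
    Qprime (y j i * y i l - y j l * y i i).

Section Cubics.

Variable t : 'I_6 -> 'I_n.

(* 1-based: [z a b] is the variable y_{i_a i_b}, for 1 <= a, b <= 6. *)
Let z (a b : nat) := y (t (inord a.-1)) (t (inord b.-1)).

Definition cubicF1 : {mpoly k[nsym n]} :=
  z 1 5 * z 2 4 * z 3 6 - z 1 4 * z 2 5 * z 3 6 - z 1 5 * z 2 3 * z 4 6
  + z 1 3 * z 2 5 * z 4 6 + z 1 4 * z 2 3 * z 5 6 - z 1 3 * z 2 4 * z 5 6.

Definition cubicF2 : {mpoly k[nsym n]} :=
  z 1 4 * z 2 6 * z 3 5 - z 1 4 * z 2 5 * z 3 6 - z 1 3 * z 2 6 * z 4 5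
  + z 1 2 * z 3 6 * z 4 5 + z 1 3 * z 2 5 * z 4 6 - z 1 2 * z 3 5 * z 4 6.

Definition cubicF3 : {mpoly k[nsym n]} :=
  z 1 6 * z 2 4 * z 3 5 - z 1 4 * z 2 5 * z 3 6 - z 1 6 * z 2 3 * z 4 5
  + z 1 2 * z 3 6 * z 4 5 + z 1 3 * z 2 5 * z 4 6 - z 1 2 * z 3 5 * z 4 6
  + z 1 4 * z 2 3 * z 5 6 - z 1 3 * z 2 4 * z 5 6.

Definition cubicF4 : {mpoly k[nsym n]} :=
  z 1 5 * z 2 6 * z 3 4 - z 1 4 * z 2 5 * z 3 6 - z 1 3 * z 2 6 * z 4 5
  + z 1 2 * z 3 6 * z 4 5 - z 1 5 * z 2 3 * z 4 6 + z 1 3 * z 2 5 * z 4 6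
  + z 1 4 * z 2 3 * z 5 6 - z 1 2 * z 3 4 * z 5 6.

Definition cubicF5 : {mpoly k[nsym n]} :=
  z 1 6 * z 2 5 * z 3 4 - z 1 4 * z 2 5 * z 3 6 - z 1 6 * z 2 3 * z 4 5
  + z 1 2 * z 3 6 * z 4 5 + z 1 4 * z 2 3 * z 5 6 - z 1 2 * z 3 4 * z 5 6.

End Cubics.

Definition cubics (h : {mpoly k[nsym n]}) : Prop :=
  exists2 t : 'I_6 -> 'I_n, (forall a b : 'I_6, (a < b)%N -> (t a < t b)%N) &
  h \in [:: cubicF1 t; cubicF2 t; cubicF3 t; cubicF4 t; cubicF5 t].

(* (Q')^+ = (Q') + H *)
Definition Qprime_plus : {mpoly k[nsym n]} -> Prop :=
  ideal_add (ideal_gen Qprime) (ideal_gen cubics).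

End Generators.

(* Main.v *)
Require Import Defs.
From HB Require Import structures.
From mathcomp Require Import all_boot all_order all_algebra all_fingroup.
From mathcomp Require Import mpoly.
From mathcomp Require Import ring zify.

Set Implicit Arguments.
Unset Strict Implicit.
Unset Printing Implicit Defensive.

Import GRing.Theory.
Local Open Scope ring_scope.

(** Let the variables a_1, ..., a_n, b_1, ..., b_n commute, and map S to k[a, b]
    by y_ij |-> a_i b_j + a_j b_i for i <> j and y_ii |-> a_i b_i
    ([frame_eval]): up to a factor 2 on the diagonal, y_ij becomes the scalar
    product of the i-th and the j-th of n vectors in the hyperbolic plane. The
    theorem holds because both Ann(perm X) and the ideal (Q')^+ consist of
    those h whose image has no squarefree monomial.

    Annihilator. Send a squarefree monomial a_T b_C with |T| = |C| to the
    permanent of the submatrix of X obtained by deleting the rows T and the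
    columns C, and every other monomial to 0 ([frame_subperm]). Expanding the
    permanent along the rows of the two entries x_ij and x_ji turns d/dx_ij
    into multiplication by the image of y_ij, so that h o perm(X) is the value
    of this map at the image of h ([apply_diff_perm]). The generators of Q' are
    sent to the ideal of the a_i^2 and b_i^2, the cubics to 0; hence
    (Q')^+ is contained in Ann(perm X) ([ideal_in_Ann]).

    Conversely, let h annihilate perm(X). Then so does g h for every g, and the
    constant term of (g h) o perm(X) is the coefficient of a_1...a_n b_1...b_n
    in the image of g h. For each (T, C) there is a g whose image is, up to a
    power of 2, a_T' b_C' + a_C' b_T' with T', C' the complements of T, C
    ([frame_eval_even_odd]); as the image of h is symmetric in a and b
    ([frame_eval_flip]), the coefficient of a_T b_C in it is 0
    ([Ann_squarefree]).

    Ideal. It remains to recover h modulo (Q')^+ from its image. Put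
    u_ij = a_i b_j + a_j b_i and v_ij = a_i b_j - a_j b_i, so that
    2 a_i b_j = u_ij + v_ij. A product of an even number of v's is a
    polynomial in the u's because v_ij v_kl is a 2 x 2 minor of the matrix of
    the u's ([gram]), so the even part of prod (u_ij + v_ij) over a list of
    oriented pairs has an explicit expression in the y's ([even_part]). All
    3 x 3 minors of the matrix of the y's lie in (Q')^+ ([ideal_minor3]), and
    this is enough to show that, modulo (Q')^+, the expression only depends on
    the multisets of first and of second entries of the pairs
    ([even_part_matching]) and vanishes if one of them has a repetition
    ([even_part_nuniq1]). It therefore defines a linear map from k[a, b] back
    to S / (Q')^+ which is left inverse to the substitution
    ([frame_lift_eval]) and which kills all non-squarefree monomials. *)

(** * Lists of pairs *)

Section PairLists.

Variable T : eqType.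
Implicit Types (i j k l : T) (e : T * T) (L : seq (T * T)).

Variable r : seq (T * T) -> seq (T * T) -> Prop.
Hypothesis r_refl : forall L, r L L.
Hypothesis r_sym : forall L L', r L L' -> r L' L.
Hypothesis r_trans : forall L L' L'', r L L' -> r L' L'' -> r L L''.
Hypothesis r_cons : forall e L L', r L L' -> r (e :: L) (e :: L').
Hypothesis r_swap : forall e e' L, r (e :: e' :: L) (e' :: e :: L).
Hypothesis r_exch : forall i j k l L,
  r ((i, j) :: (k, l) :: L) ((i, l) :: (k, j) :: L).

Arguments r_sym {L L'}.
Arguments r_trans {L L' L''}.
Arguments r_cons e {L L'}.

Lemma pairs_perm L L' : perm_eq L L' -> r L L'.
Proof.
elim: L L' => [|e L IH] L'.
  by rewrite perm_sym => /perm_nilP ->; apply: r_refl.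
move=> peq; have eL' : e \in L' by rewrite -(perm_mem peq) mem_head.
have [p1 [p2 def]] : exists p1 p2, L' = p1 ++ e :: p2.
  by case/path.splitPr: eL' => p1 p2; exists p1, p2.
have front : r (p1 ++ e :: p2) (e :: p1 ++ p2).
  elim: (p1) => [|e' p IHp] /=; first exact: r_refl.
  by apply: (r_trans (r_cons e' IHp)); apply: r_swap.
rewrite def; apply: (r_trans _ (r_sym front)); apply: r_cons; apply: IH.
by rewrite -(perm_cons e) (permPl peq) def perm_catC /= perm_cons perm_catC.
Qed.

(** Transposing the second entries of two pairs generates all ways of matching
    given first entries with given second entries. *)
Lemma pairs_matching L L' :
    perm_eq (unzip1 L) (unzip1 L') -> perm_eq (unzip2 L) (unzip2 L') ->
  r L L'.
Proof.
elim: L L' => [|[i j] L IH] L' /=.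
  by rewrite perm_sym => /perm_nilP; case: L' => // _ _; apply: r_refl.
move=> p1 p2.
have /mapP[[i' l] il /= ii'] : i \in unzip1 L'.
  by rewrite -(perm_mem p1) mem_head.
subst i'.
have pL' := perm_to_rem il; move: p1 p2; set L1 := rem _ _ in pL' *.
rewrite (permPr (perm_map fst pL')) (permPr (perm_map snd pL')) /= perm_cons.
move=> p1 p2; apply: (r_trans _ (r_sym (pairs_perm pL'))).
have [jl | neq_jl] := eqVneq j l.
  by subst l; rewrite perm_cons in p2; apply: r_cons; apply: IH.
have : j \in l :: unzip2 L1 by rewrite -(perm_mem p2) mem_head.
rewrite inE (negPf neq_jl) /= => /mapP[[k j'] kj /= jj']; subst j'.
have pL1 := perm_to_rem kj; move: p1 p2; set L2 := rem _ _ in pL1 *.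
rewrite (permPr (perm_map fst pL1)) /= => p1.
have e2 : perm_eq (unzip2 L1) (j :: unzip2 L2) := perm_map snd pL1.
have /permPr -> : perm_eq (l :: unzip2 L1) (j :: l :: unzip2 L2).
  rewrite -(perm_cons l) in e2; apply: perm_trans e2 _.
  exact: permEl (perm_catCA [:: l] [:: j] (unzip2 L2)).
rewrite perm_cons => p2.
apply: (r_trans _ (r_sym (r_cons _ (pairs_perm pL1)))).
apply: (r_trans _ (r_exch _ _ _ _ _)); apply: r_cons; exact: IH.
Qed.

End PairLists.

Lemma nuniq_unzip1 (T : eqType) (L : seq (T * T)) :
  ~~ uniq (unzip1 L) ->
  exists i j l L', perm_eq L ((i, j) :: (i, l) :: L').
Proof.
elim: L => //= -[i j] L IH; rewrite negb_and negbK => /orP[|/IH].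
  case/mapP=> -[i' l] il /= ->; exists i', j, l, (rem (i', l) L).
  by rewrite perm_cons perm_to_rem.
case=> i' [j' [l [L' pL]]]; exists i', j', l, ((i, j) :: L').
have /permPl -> : perm_eq ((i, j) :: L) ((i, j) :: (i', j') :: (i', l) :: L').
  by rewrite perm_cons.
exact: permEl (perm_catCA [:: (i, j)] [:: (i', j'); (i', l)] L').
Qed.

(** * Symmetric matrices of rank two *)

Definition minor3 (A : comNzRingType) (T : Type) (U : T -> T -> A)
    (i j k l p q : T) : A :=
  U i l * (U j p * U k q - U j q * U k p)
  - U i p * (U j l * U k q - U j q * U k l)
  + U i q * (U j l * U k p - U j p * U k l).

Definition flip (T : Type) (e : T * T) := (e.2, e.1).
Arguments flip {T} e.

(** The ideal I stands for (Q')^+ and U for the matrix of scalar products of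
    vectors in a plane, known only modulo I: its 3 x 3 minors are in I, and
    I_half holds in the hyperbolic plane modulo the squares of the
    coordinates. *)
Section RankTwo.

Variables (A : comNzRingType) (T : eqType).
Variable I : A -> Prop.
Hypothesis I0 : I 0.
Hypothesis ID : forall x y, I x -> I y -> I (x + y).
Hypothesis IM : forall c x, I x -> I (c * x).

Variables (U : T -> T -> A) (inv2 : A).
Hypothesis inv2E : inv2 + inv2 = 1.
Hypothesis UC : forall i j, U i j = U j i.
Hypothesis I_minor : forall i j k l p q, I (minor3 U i j k l p q).
Hypothesis I_half : forall i j l, I (U i j * U i l - inv2 * U i i * U j l).

Implicit Types (e : T * T) (L : seq (T * T)).

Lemma ideal_opp x : I x -> I (- x).
Proof. by rewrite -mulN1r; apply: IM. Qed.

Lemma ideal_eq x y : x = y -> I x -> I y. Proof. by move=> ->. Qed.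

(** The product v_ij v_kl of two determinants, written in scalar products. *)
Definition gram e e' : A := U e.1 e'.2 * U e.2 e'.1 - U e.1 e'.1 * U e.2 e'.2.

(** The product of the u_e + v_e over L is an even element plus an odd element
    of the ring generated by the u's and v's. The odd one is no polynomial in
    the u's, so it is recorded through its products with each v_e. *)
Fixpoint evod L : A * (T * T -> A) :=
  if L is e' :: L' then
    (U e'.1 e'.2 * (evod L').1 + (evod L').2 e',
     fun e => U e'.1 e'.2 * (evod L').2 e + gram e' e * (evod L').1)
  else (1, fun=> 0).
Definition even_part L := (evod L).1.
Definition odd_part L := (evod L).2.

Lemma odd_part_flip L e : odd_part L (flip e) = - odd_part L e.
Proof.
rewrite /odd_part; elim: L => [|e' L IH] /=; first by rewrite oppr0.
by rewrite IH /gram /flip /=; ring.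
Qed.

Lemma even_odd_flip L :
  even_part (map flip L) = even_part L /\
  (forall e, odd_part (map flip L) e = - odd_part L e).
Proof.
rewrite /even_part /odd_part; elim: L => [|e' L [IHe IHo]] /=.
  by split=> // e; rewrite oppr0.
split=> [|e]; rewrite IHe IHo; last by rewrite /gram (UC e'.2 e'.1) /=; ring.
by rewrite [X in - X]odd_part_flip opprK (UC e'.2).
Qed.

(** Reversing a pair changes the sign of v_e and therefore cancels the odd
    contribution: the sum is 2 u_e times the even part. *)
Lemma even_partDflip e L :
  even_part (e :: L) + even_part (flip e :: L) =
    U e.1 e.2 * even_part L + U e.1 e.2 * even_part L.
Proof.
rewrite /even_part /=.
have := odd_part_flip L e; rewrite /odd_part => ->.
by rewrite /flip /= (UC e.2 e.1); ring.
Qed.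

Lemma gramC e e' : gram e e' = gram e' e.
Proof.
rewrite /gram (UC e'.1 e.2) (UC e'.2 e.1) (UC e'.1 e.1) (UC e'.2 e.2).
by ring.
Qed.

(** Associativity of the product of four v's. The 3 x 3 minors allow v_ij to be
    moved past the two factors of each term of the second [gram], one factor at
    a time, which takes four minors. *)
Lemma gram_exchange e1 e2 e3 e4 :
  I (gram e1 e2 * gram e3 e4 - gram e1 e3 * gram e2 e4).
Proof.
case: e1 e2 e3 e4 => [i j] [k l] [p q] [u v].
pose m a b c d := minor3 U a b c d k l.
have Im a b c d x : I (x * m a b c d) by apply/IM/I_minor.
apply: ideal_eq (ID (ID (Im i j u p (U q v)) (Im i j v p (- U q u)))
                    (ID (Im j v u q (U i p)) (Im u i v q (- U j p)))).
rewrite /m /minor3 /gram /=.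
rewrite !(UC j i, UC k i, UC l i, UC p i, UC q i, UC u i, UC v i, UC k j, UC
  l j, UC p j, UC q j, UC u j, UC v j, UC l k, UC p k, UC q k, UC u k, UC v
  k, UC p l, UC q l, UC u l, UC v l, UC q p, UC u p, UC v p, UC u q, UC v q,
  UC v u).
ring.
Qed.

(** Well-definedness of the product of [odd_part] L with two v's. *)
Lemma odd_part_exchange L e e1 e2 :
  I (gram e1 e * odd_part L e2 - gram e2 e * odd_part L e1).
Proof.
rewrite /odd_part; elim: L => [|e' L IH] /=.
  by apply: (ideal_eq _ I0); ring.
have h := gram_exchange e e1 e2 e'.
apply: ideal_eq (ID (IM (U e'.1 e'.2) IH) (IM (evod L).1 h)).
by rewrite (gramC e1 e) (gramC e2 e) (gramC e2 e') (gramC e1 e'); ring.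
Qed.

Definition parts_cong L L' := I (even_part L - even_part L') /\
  forall e, I (odd_part L e - odd_part L' e).

Lemma parts_cong_refl L : parts_cong L L.
Proof. by split=> [|e]; rewrite subrr. Qed.

Lemma parts_cong_sym L L' : parts_cong L L' -> parts_cong L' L.
Proof.
by case=> h1 h2; split=> [|e]; rewrite -opprB; apply: ideal_opp.
Qed.

Lemma parts_cong_trans L L' L'' :
  parts_cong L L' -> parts_cong L' L'' -> parts_cong L L''.
Proof.
case=> h1 h2 [h3 h4]; split=> [|e].
  by apply: ideal_eq (ID h1 h3); ring.
by apply: ideal_eq (ID (h2 e) (h4 e)); ring.
Qed.

Lemma parts_cong_cons e L L' : parts_cong L L' -> parts_cong (e :: L) (e :: L').
Proof.
case=> h1 h2; rewrite /parts_cong /even_part /odd_part /=; split=> [|e'].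
  apply: ideal_eq (ID (IM (U e.1 e.2) h1) (h2 e)).
  by rewrite /even_part /odd_part; ring.
apply: ideal_eq (ID (IM (U e.1 e.2) (h2 e')) (IM (gram e e') h1)).
by rewrite /even_part /odd_part; ring.
Qed.

Lemma parts_cong_swap e e' L : parts_cong (e :: e' :: L) (e' :: e :: L).
Proof.
split=> [|f]; rewrite /even_part /odd_part /=.
  by apply: ideal_eq I0; rewrite (gramC e); ring.
apply: ideal_eq (odd_part_exchange L f e e').
by rewrite /odd_part; ring.
Qed.

(** Three vectors of a plane are linearly dependent. *)
Lemma odd_part_cyclic L i j k l :
  I (odd_part L (i, j) * U k l + odd_part L (j, k) * U i l
     + odd_part L (k, i) * U j l).
Proof.
rewrite /odd_part; elim: L => [|[p q] L IH] /=.
  by apply: ideal_eq I0; ring.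
apply: ideal_eq (ID (IM (U p q) IH)
  (IM (- (evod L).1) (I_minor i j k l p q))).
rewrite /minor3 /gram /= !(UC p i, UC p j, UC p k, UC p l, UC q i, UC q j,
  UC q k, UC q l).
by ring.
Qed.

(** This is the odd part of (u_ij + v_ij) (u_il + v_il) = 4 a_i^2 b_j b_l, a
    multiple of a square. *)
Lemma odd_part_half L i j l :
  I (U i j * odd_part L (i, l) + U i l * odd_part L (i, j)).
Proof.
rewrite /odd_part; elim: L => [|[p q] L IH] /=.
  by apply: ideal_eq I0; ring.
have h a b c : I (c * (U i a * U i b - inv2 * U i i * U a b)).
  exact/IM/I_half.
pose x := (evod L).1.
apply: ideal_eq (ID (IM (U p q) IH)
  (ID (ID (h j q (x * U p l)) (h j p (- (x * U q l))))
      (ID (h l q (x * U p j)) (h l p (- (x * U q j)))))).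
rewrite /gram /x /= !(UC p i, UC p j, UC p l, UC q i, UC q j, UC q l, UC l
  j, UC q p).
by ring.
Qed.

(** The identity (u_ij + v_ij) (u_kl + v_kl) = (u_il + v_il) (u_kj + v_kj), both
    sides being 4 a_i a_k b_j b_l. *)
Lemma parts_cong_exch i j k l L :
  parts_cong ((i, j) :: (k, l) :: L) ((i, l) :: (k, j) :: L).
Proof.
have c1 := odd_part_cyclic L k l i j; have c2 := odd_part_cyclic L i j k l.
have fl a b := odd_part_flip L (a, b); rewrite /flip /= in fl.
split=> [|[p q]]; rewrite /even_part /odd_part /=.
  apply: ideal_eq (ID c1 c2).
  rewrite (fl i k) (fl i l) (fl k j) /odd_part /gram /=.
  rewrite !(UC k i, UC j i, UC l i, UC k j, UC l j, UC l k).
  ring.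
have h1 := odd_part_exchange L (i, j) (p, q) (k, l).
have h2 := IM (- 1) (odd_part_exchange L (i, l) (p, q) (k, j)).
have d1 := odd_part_cyclic [:: (p, q)] k l i j.
have d2 := odd_part_cyclic [:: (p, q)] i j k l.
apply: ideal_eq (ID (ID h1 h2) (IM (even_part L) (ID d1 d2))).
rewrite /even_part /odd_part /= /gram /=.
rewrite !(UC k i, UC j i, UC l i, UC k j, UC l j, UC l k, UC p i, UC p j, UC
  p k, UC p l, UC q i, UC q j, UC q k, UC q l).
ring.
Qed.

Lemma even_part_matching L L' :
    perm_eq (unzip1 L) (unzip1 L') -> perm_eq (unzip2 L) (unzip2 L') ->
  I (even_part L - even_part L').
Proof.
move=> p1 p2; suff [] : parts_cong L L' by [].
apply: pairs_matching p1 p2;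
  [ exact: parts_cong_refl | exact: parts_cong_sym | exact: parts_cong_trans
  | exact: parts_cong_cons | exact: parts_cong_swap | exact: parts_cong_exch ].
Qed.

Lemma even_part_perm L L' : perm_eq L L' -> I (even_part L - even_part L').
Proof. by move=> pL; apply: even_part_matching; apply: perm_map. Qed.

Lemma even_part_nuniq1 L : ~~ uniq (unzip1 L) -> I (even_part L).
Proof.
move/nuniq_unzip1=> [i [j [l [L' pL]]]].
have h1 := odd_part_half L' i j l.
have h2 : I (U i j * U i l + U i j * U i l - U i i * U j l).
  apply: ideal_eq (ID (I_half i j l) (I_half i j l)).
  by rewrite -[in RHS](mul1r (U i i)) -inv2E; ring.
apply: ideal_eq (ID (even_part_perm pL) (ID h1 (IM (even_part L') h2))).
rewrite /even_part /odd_part /= /gram /= (UC l i) (UC l j).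
by ring.
Qed.

Lemma even_part_nuniq2 L : ~~ uniq (unzip2 L) -> I (even_part L).
Proof.
have [<- _] := even_odd_flip L => nu; apply: even_part_nuniq1.
by rewrite /unzip1 -map_comp.
Qed.

End RankTwo.

(** * Ideals given by generators *)

Section IdealGen.

Variable A : comNzRingType.
Implicit Types (G H : A -> Prop) (x y c : A).

Lemma ideal_gen0 G : ideal_gen G 0.
Proof. by exists [::]; rewrite // big_nil. Qed.

Lemma ideal_genD G x y : ideal_gen G x -> ideal_gen G y -> ideal_gen G (x + y).
Proof.
case=> s Gs -> [t Gt ->]; exists (s ++ t); last by rewrite big_cat.
by move=> u; rewrite mem_cat => /orP[/Gs | /Gt].
Qed.

Lemma ideal_genM G c x : ideal_gen G x -> ideal_gen G (c * x).
Proof.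
case=> s Gs ->; exists [seq (c * u.1, u.2) | u <- s].
  by move=> _ /mapP[u /Gs Gu ->].
by rewrite big_map mulr_sumr; apply: eq_bigr => u _; rewrite mulrA.
Qed.

Lemma mem_ideal_gen G x : G x -> ideal_gen G x.
Proof.
move=> Gx; exists [:: (1, x)]; last by rewrite big_seq1 mul1r.
by move=> u; rewrite inE => /eqP ->.
Qed.

Lemma ideal_genS G H x :
  (forall z, G z -> ideal_gen H z) -> ideal_gen G x -> ideal_gen H x.
Proof.
move=> sGH [s Gs ->]; rewrite big_seq; apply: big_ind => [||u us].
- exact: ideal_gen0.
- by move=> y z; apply: ideal_genD.
exact/ideal_genM/sGH/Gs.
Qed.

Lemma ideal_addE G H x :
  ideal_add (ideal_gen G) (ideal_gen H) x <-> ideal_gen (fun z => G z \/ H z) x.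
Proof.
split=> [[y [z [Gy Hz ->]]] | [s Gs ->]].
  apply: ideal_genD.
    by apply: ideal_genS Gy => w Gw; apply: mem_ideal_gen; left.
  by apply: ideal_genS Hz => w Hw; apply: mem_ideal_gen; right.
rewrite big_seq; apply: big_ind => [||[c z] /Gs /= GHz].
- by exists 0, 0; rewrite addr0; split=> //; apply: ideal_gen0.
- move=> _ _ [y [z [Gy Hz ->]]] [y' [z' [Gy' Hz' ->]]].
  by exists (y + y'), (z + z'); rewrite addrACA; split=> //; apply: ideal_genD.
case: GHz => Gz; [exists (c * z), 0 | exists 0, (c * z)];
  by rewrite ?addr0 ?add0r; split=> //;
    do ?[exact: ideal_gen0 | exact/ideal_genM/mem_ideal_gen].
Qed.

End IdealGen.

(** * The minors of the generic matrix lie in the ideal *)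

Lemma char_two_neq0 (k : fieldType) : char_zero_or_gt2 k -> 2%:R != 0 :> k.
Proof.
move=> kc; apply/negP=> /eqP two0.
have two : 2 \in [pchar k] by rewrite inE /= two0 eqxx.
case: kc => [ch0 | [p chp p2]]; first by rewrite ch0 in two.
have := pcharf_eq chp 2; rewrite two !inE => /esym/eqP p2E.
by rewrite -p2E in p2.
Qed.

(** Stated for an abstract morphism: over an abstract ring the identities are
    plain polynomial identities in the r's and c's. *)
Lemma cubics_vanish (A B : comNzRingType) (f : {rmorphism A -> B})
    (z : nat -> nat -> A) (r c : nat -> B) :
    (forall a b, [&& 0 < a, a < b & b <= 6]%N ->
       f (z a b) = r a * c b + r b * c a) ->
  [/\ f (z 1 5 * z 2 4 * z 3 6 - z 1 4 * z 2 5 * z 3 6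
        - z 1 5 * z 2 3 * z 4 6 + z 1 3 * z 2 5 * z 4 6
        + z 1 4 * z 2 3 * z 5 6 - z 1 3 * z 2 4 * z 5 6) = 0,
      f (z 1 4 * z 2 6 * z 3 5 - z 1 4 * z 2 5 * z 3 6
        - z 1 3 * z 2 6 * z 4 5 + z 1 2 * z 3 6 * z 4 5
        + z 1 3 * z 2 5 * z 4 6 - z 1 2 * z 3 5 * z 4 6) = 0,
      f (z 1 6 * z 2 4 * z 3 5 - z 1 4 * z 2 5 * z 3 6
        - z 1 6 * z 2 3 * z 4 5 + z 1 2 * z 3 6 * z 4 5
        + z 1 3 * z 2 5 * z 4 6 - z 1 2 * z 3 5 * z 4 6
        + z 1 4 * z 2 3 * z 5 6 - z 1 3 * z 2 4 * z 5 6) = 0,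
      f (z 1 5 * z 2 6 * z 3 4 - z 1 4 * z 2 5 * z 3 6
        - z 1 3 * z 2 6 * z 4 5 + z 1 2 * z 3 6 * z 4 5
        - z 1 5 * z 2 3 * z 4 6 + z 1 3 * z 2 5 * z 4 6
        + z 1 4 * z 2 3 * z 5 6 - z 1 2 * z 3 4 * z 5 6) = 0 &
      f (z 1 6 * z 2 5 * z 3 4 - z 1 4 * z 2 5 * z 3 6
        - z 1 6 * z 2 3 * z 4 5 + z 1 2 * z 3 6 * z 4 5
        + z 1 4 * z 2 3 * z 5 6 - z 1 2 * z 3 4 * z 5 6) = 0].
Proof.
by move=> fz; split;
  rewrite !(rmorphD, rmorphN, rmorphM) /= !fz //; ring.
Qed.

Section SymForms.

Variables (n : nat) (k : fieldType).

(** Doubling the diagonal makes the substitution uniform: the image of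
    [sym_form i j] is a_i b_j + a_j b_i whether or not i = j. *)
Definition sym_form (i j : 'I_n) : {mpoly k[nsym n]} :=
  if i == j then yvar k i i + yvar k i i else yvar k i j.

Local Notation U := sym_form.

Lemma sym_formC i j : U i j = U j i.
Proof.
rewrite /U (eq_sym j); case: eqVneq => [-> // | _].
by rewrite /yvar symidxC.
Qed.

Local Notation I := (ideal_gen (fun g => Qprime g \/ @cubics n k g)).

Lemma ideal_Qprime c g : Qprime g -> I (c * g).
Proof. by move=> Qg; apply: ideal_genM; apply: mem_ideal_gen; left. Qed.

Lemma ideal_gen_eq (x y : {mpoly k[nsym n]}) : x = y -> I x -> I y.
Proof. by move=> ->. Qed.

Local Notation y := (@yvar n k).

Lemma yvarC (i j : 'I_n) : yvar k i j = yvar k j i.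
Proof. by rewrite /yvar symidxC. Qed.

(** The matching y_{1,4} y_{2,5} y_{3,6} apart, each of the six products that
    pair {1, 2, 3} with {4, 5, 6} occurs in exactly one of the five cubics, with
    coefficient 1; its coefficient in a minor is thus the coefficient of that
    cubic in the minor. *)
Lemma minor3_sorted (x1 x2 x3 x4 x5 x6 : 'I_n) :
    [&& x1 < x2, x2 < x3, x3 < x4, x4 < x5 & x5 < x6]%N ->
  [/\ I (minor3 y x1 x2 x3 x4 x5 x6),
      I (minor3 y x1 x2 x4 x3 x5 x6),
      I (minor3 y x1 x2 x5 x3 x4 x6),
      I (minor3 y x1 x2 x6 x3 x4 x5) &
      I (minor3 y x1 x3 x4 x2 x5 x6)] /\
  [/\ I (minor3 y x1 x3 x5 x2 x4 x6),
      I (minor3 y x1 x3 x6 x2 x4 x5),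
      I (minor3 y x1 x4 x5 x2 x3 x6),
      I (minor3 y x1 x4 x6 x2 x3 x5) &
      I (minor3 y x1 x5 x6 x2 x3 x4)].
Proof.
move=> lt_x; pose t (a : 'I_6) := nth x1 [:: x1; x2; x3; x4; x5; x6] a.
have t_incr (a b : 'I_6) : (a < b)%N -> (t a < t b)%N.
  rewrite /t; case: a b => [[|[|[|[|[|[|a]]]]]] ?] [[|[|[|[|[|[|b]]]]]] ?] //=;
    by case/and5P: lt_x; lia.
pose Fs := [:: cubicF1 k t; cubicF2 k t; cubicF3 k t; cubicF4 k t; cubicF5 k t].
have I_F r c : (r < 5)%N -> I (c * Fs`_r).
  move=> lt_r; apply/ideal_genM/mem_ideal_gen; right; exists t => //.
  exact: mem_nth.
have tE m : (m < 6)%N ->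
    t (inord m) = nth x1 [:: x1; x2; x3; x4; x5; x6] m.
  by move=> lt_m; rewrite /t inordK.
rewrite /Fs /cubicF1 /cubicF2 /cubicF3 /cubicF4 /cubicF5 !tE //= in I_F.
split; split; rewrite /minor3 ?(yvarC x2 x1, yvarC x3 x1, yvarC x4 x1, yvarC
  x5 x1, yvarC x6 x1, yvarC x3 x2, yvarC x4 x2, yvarC x5 x2, yvarC x6 x2,
  yvarC x4 x3, yvarC x5 x3, yvarC x6 x3, yvarC x5 x4, yvarC x6 x4, yvarC x6
  x5).
- apply: ideal_gen_eq (ideal_genD (ideal_genD (ideal_genD (ideal_genD (I_F 0
  (- 1) isT) (I_F 1 (- 1) isT)) (I_F 2 1 isT)) (I_F 3 1 isT)) (I_F 4 (- 1)
  isT)); rewrite /=; ring.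
- apply: ideal_gen_eq (ideal_genD (I_F 3 1 isT) (I_F 4 (- 1) isT)); rewrite
  /=; ring.
- apply: ideal_gen_eq (ideal_genD (I_F 1 1 isT) (I_F 2 (- 1) isT)); rewrite
  /=; ring.
- apply: ideal_gen_eq (I_F 0 (- 1) isT); rewrite /=; ring.
- apply: ideal_gen_eq (ideal_genD (I_F 0 1 isT) (I_F 2 (- 1) isT)); rewrite
  /=; ring.
- apply: ideal_gen_eq (I_F 4 (- 1) isT); rewrite /=; ring.
- apply: ideal_gen_eq (ideal_genD (I_F 1 1 isT) (I_F 3 (- 1) isT)); rewrite
  /=; ring.
- apply: ideal_gen_eq (ideal_genD (I_F 2 1 isT) (I_F 4 (- 1) isT)); rewrite
  /=; ring.
- apply: ideal_gen_eq (ideal_genD (I_F 0 1 isT) (I_F 3 (- 1) isT)); rewrite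
  /=; ring.
- apply: ideal_gen_eq (I_F 1 (- 1) isT); rewrite /=; ring.
Qed.

Hypothesis two_neq0 : 2%:R != 0 :> k.

Definition inv2 : {mpoly k[nsym n]} := (2%:R^-1)%:MP.

Lemma inv2E : inv2 + inv2 = 1.
Proof.
rewrite /inv2 -mpolyCD -mpolyC1; congr (_ %:MP).
by rewrite -[LHS]mulr2n -[LHS]mulr_natl mulfV.
Qed.

(** The three families of quadratic generators, in one formula. *)
Lemma sym_form_half i j l : I (U i j * U i l - inv2 * U i i * U j l).
Proof.
have hh (x : {mpoly k[nsym n]}) : inv2 * (x + x) = x.
  by rewrite mulrDr -mulrDl inv2E mul1r.
rewrite /U eqxx hh.
have [ji | ji] := eqVneq j i; have [li | li] := eqVneq l i; try subst j;
  try subst l; rewrite ?eqxx ?(negPf ji) ?(negPf li).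
- by apply: ideal_gen_eq (ideal_Qprime 2%:R (Qprime_a k i i)); ring.
- rewrite eq_sym (negPf li).
  by apply: ideal_gen_eq (ideal_Qprime 1 (Qprime_a k i l)); ring.
- rewrite (yvarC j i).
  by apply: ideal_gen_eq (ideal_Qprime 1 (Qprime_a k i j)); ring.
have [jl | jl] := eqVneq j l.
  subst l; apply: ideal_gen_eq (ideal_Qprime 1 (Qprime_b k ji)).
  by rewrite (yvarC j i); ring.
rewrite eq_sym in ji; rewrite eq_sym in li.
apply: ideal_gen_eq (ideal_Qprime 1 (Qprime_c k ji li jl)).
by rewrite (yvarC j i); ring.
Qed.

Lemma minor3_row_swap12 (a b c d e f : 'I_n) :
  I (minor3 U a b c d e f) -> I (minor3 U b a c d e f).
Proof.
by move=> /(ideal_genM (- 1)); apply: ideal_gen_eq; rewrite /minor3; ring.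
Qed.

Lemma minor3_row_swap23 (a b c d e f : 'I_n) :
  I (minor3 U a b c d e f) -> I (minor3 U a c b d e f).
Proof.
by move=> /(ideal_genM (- 1)); apply: ideal_gen_eq; rewrite /minor3; ring.
Qed.

Lemma minor3_tr (a b c d e f : 'I_n) :
  I (minor3 U a b c d e f) -> I (minor3 U d e f a b c).
Proof.
apply: ideal_gen_eq; rewrite /minor3 !(sym_formC d a, sym_formC d b,
  sym_formC d c, sym_formC e a, sym_formC e b, sym_formC e c, sym_formC f a,
  sym_formC f b, sym_formC f c).
by ring.
Qed.

(** With a row index equal to a column index the minor already lies in (Q'):
    each of its terms is rewritten as a multiple of U i i, and these cancel. *)
Lemma minor3_repeat (i j m p q : 'I_n) : I (minor3 U i j m i p q).
Proof.
have h c a b : I (c * (U i a * U i b - inv2 * U i i * U a b)).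
  exact/ideal_genM/sym_form_half.
have hh (x : {mpoly k[nsym n]}) : inv2 * x + inv2 * x = x.
  by rewrite -mulrDl inv2E mul1r.
apply: ideal_gen_eq (ideal_genD
  (ideal_genD (h (- U m q) j p) (h (U j q) m p))
  (ideal_genD (h (U m p) j q) (h (- U j p) m q))).
rewrite /minor3 (sym_formC j i) (sym_formC m i).
rewrite -[U i i in RHS]hh.
by ring.
Qed.

Definition distinct3 (T : eqType) (a b c : T) := [&& a != b, a != c & b != c].

Lemma sort3_ind (P : 'I_n -> 'I_n -> 'I_n -> Prop) :
    (forall a b c, P a b c -> P b a c) -> (forall a b c, P a b c -> P a c b) ->
    (forall a b c : 'I_n, (a < b < c)%N -> P a b c) ->
  forall a b c, distinct3 a b c -> P a b c.
Proof.
move=> P12 P23 Ps a b c /and3P[]; rewrite -!val_eqE /= => ab ac bc.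
have [lab | lba | /eqP] := ltngtP a b; last by rewrite (negPf ab).
  have [lbc | lcb | /eqP] := ltngtP b c; last by rewrite (negPf bc).
    by apply: Ps; rewrite lab.
  have [lac | lca | /eqP] := ltngtP a c; last by rewrite (negPf ac).
    by apply/P23/Ps; rewrite lac.
  by apply/P23/P12/Ps; rewrite lca.
have [lac | lca | /eqP] := ltngtP a c; last by rewrite (negPf ac).
  by apply/P12/Ps; rewrite lba.
have [lbc | lcb | /eqP] := ltngtP b c; last by rewrite (negPf bc).
  by apply/P12/P23/Ps; rewrite lbc.
by apply/P12/P23/P12/Ps; rewrite lcb.
Qed.

Lemma minor3_disjoint (a b c d e f : 'I_n) :
    (a < b < c)%N -> (d < e < f)%N -> (a < d)%N ->
    all (fun x => x \notin [:: d; e; f]) [:: a; b; c] ->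
  I (minor3 U a b c d e f).
Proof.
move=> /andP[ab bc] /andP[de ef] ad; rewrite /= !inE !negb_or andbT.
move=> /and3P[/and3P[nad nae naf] /and3P[nbd nbe nbf] /and3P[ncd nce ncf]].
have -> : minor3 U a b c d e f = minor3 y a b c d e f.
  rewrite /minor3 /U (negPf nad) (negPf nae) (negPf naf) (negPf nbd).
  by rewrite (negPf nbe) (negPf nbf) (negPf ncd) (negPf nce) (negPf ncf).
rewrite -!val_eqE /= in nbd nbe nbf ncd nce ncf.
have srt x1 x2 x3 x4 x5 x6 := @minor3_sorted x1 x2 x3 x4 x5 x6.
have [bd | db] := ltnP b d.
  have [cd | dc] := ltnP c d.
    by case: (srt a b c d e f) => [|[]]; first lia.
  have [ce | ec] := ltnP c e.
    by case: (srt a b d c e f) => [|[]]; first lia.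
  have [cf | fc] := ltnP c f.
    by case: (srt a b d e c f) => [|[]]; first lia.
  by case: (srt a b d e f c) => [|[]]; first lia.
have [be | eb] := ltnP b e.
  have [ce | ec] := ltnP c e.
    by case: (srt a d b c e f) => [|[]]; first lia.
  have [cf | fc] := ltnP c f.
    by case: (srt a d b e c f) => [|_ []]; first lia.
  by case: (srt a d b e f c) => [|_ []]; first lia.
have [bf | fb] := ltnP b f.
  have [cf | fc] := ltnP c f.
    by case: (srt a d e b c f) => [|_ []]; first lia.
  by case: (srt a d e b f c) => [|_ []]; first lia.
by case: (srt a d e f b c) => [|_ []]; first lia.
Qed.

(** By antisymmetry in rows and in columns and by transposition, the index sets
    may be taken sorted, with the smallest index among the rows. *)
Lemma ideal_minor3 (a b c d e f : 'I_n) : I (minor3 U a b c d e f).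
Proof.
pose P a b c d e f := I (minor3 U a b c d e f).
have col12 x1 x2 x3 y1 y2 y3 : P x1 x2 x3 y1 y2 y3 -> P x1 x2 x3 y2 y1 y3.
  by move/minor3_tr/minor3_row_swap12/minor3_tr.
have col23 x1 x2 x3 y1 y2 y3 : P x1 x2 x3 y1 y2 y3 -> P x1 x2 x3 y1 y3 y2.
  by move/minor3_tr/minor3_row_swap23/minor3_tr.
have zero x : x = 0 -> I x by move=> ->; apply: ideal_gen0.
have [abc | nabc] := boolP (distinct3 a b c); last first.
  apply: zero; rewrite !negb_and !negbK in nabc.
  by case/or3P: nabc => /eqP ->; rewrite /minor3; ring.
have [def | ndef] := boolP (distinct3 d e f); last first.
  apply: zero; rewrite !negb_and !negbK in ndef.
  by case/or3P: ndef => /eqP ->; rewrite /minor3; ring.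
rewrite -/(P a b c d e f); move: a b c abc d e f def.
apply: sort3_ind => [a b c Pabc d e f /Pabc | a b c Pabc d e f /Pabc |
                     a b c abc].
- exact: minor3_row_swap12.
- exact: minor3_row_swap23.
apply: sort3_ind => [d e f | d e f | d e f def];
  [exact: col12 | exact: col23 |].
have [disj | ] := boolP (all (fun x => x \notin [:: d; e; f]) [:: a; b; c]).
  have [ad | da | /val_inj eq_ad] := ltngtP a d.
  - exact: minor3_disjoint.
  - apply/minor3_tr/minor3_disjoint => //.
    apply/allP=> x xd; apply/negP=> xa; have /allP/(_ _ xa) := disj.
    by rewrite xd.
  by rewrite eq_ad /= mem_head in disj.
have rep x x2 x3 y2 y3 : P x x2 x3 x y2 y3 by apply: minor3_repeat.
have row12 x1 x2 x3 y1 y2 y3 : P x1 x2 x3 y1 y2 y3 -> P x2 x1 x3 y1 y2 y3.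
  exact: minor3_row_swap12.
have row23 x1 x2 x3 y1 y2 y3 : P x1 x2 x3 y1 y2 y3 -> P x1 x3 x2 y1 y2 y3.
  exact: minor3_row_swap23.
have rep1 x x2 x3 y1 y2 y3 : x \in [:: y1; y2; y3] -> P x x2 x3 y1 y2 y3.
  rewrite !inE => /or3P[] /eqP <-; [exact: rep | exact/col12/rep |].
  exact/col23/col12/rep.
case/allPn=> x xabc; rewrite negbK => h; move: xabc h.
rewrite {1}inE; case/predU1P=> [-> | ]; last rewrite {1}inE => /predU1P[-> | ];
  last rewrite mem_seq1 => /eqP ->; move=> h.
- exact: rep1.
- exact/row12/rep1.
exact/row23/row12/rep1.
Qed.

End SymForms.

(** * Permanents of submatrices *)

Section SubPermanents.

Variables (n : nat) (k : fieldType).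

Local Notation S := {mpoly k[nsym n]}.
Local Notation pair := ('I_n * 'I_n)%type.
Implicit Types (i j p q : 'I_n) (e : pair) (L : seq pair).

Local Notation x_ i j := ('X_(symidx i j) : {mpoly k[nsym n]}).

Definition extends (s : 'S_n) L := all (fun e => s e.1 == e.2) L.

(** The permanent of the submatrix without the rows [unzip1 L] and the columns
    [unzip2 L], as a sum over the permutations of all indices that extend L:
    with this encoding the expansion along a row needs no bijection. *)
Definition subperm L : S :=
  if uniq (unzip1 L) then
    \sum_(s : 'S_n | extends s L) \prod_(i | i \notin unzip1 L) x_ i (s i)
  else 0.

Lemma subperm_nil : subperm [::] = permanent (generic_sym n k).
Proof.
rewrite /subperm /permanent /=; apply: eq_bigr => s _.
by apply: eq_bigr => i _; rewrite mxE.
Qed.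

Lemma extends_unzip2 s L : extends s L -> unzip2 L = map s (unzip1 L).
Proof. by elim: L => //= e L IH /andP[/eqP -> /IH ->]. Qed.

Lemma subperm_nuniq2 L : ~~ uniq (unzip2 L) -> subperm L = 0.
Proof.
move=> nu2; rewrite /subperm; case: ifP => // u1; apply: big_pred0 => s.
apply: contraNF nu2 => /extends_unzip2 ->.
by rewrite map_inj_uniq //; apply: perm_inj.
Qed.

Lemma subperm_perm L L' : perm_eq L L' -> subperm L = subperm L'.
Proof.
move=> pL; have p1 := perm_map fst pL.
rewrite /subperm (perm_uniq p1); case: ifP => // _.
apply: eq_big => [s | s _]; first by rewrite /extends (perm_all _ pL).
by apply: eq_bigl => i; rewrite (perm_mem p1).
Qed.

(** Composition with the transposition of the rows i and p exchanges the two
    sets of permutations and leaves the remaining entries alone. *)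
Lemma subperm_exch i j p q L :
  subperm ((i, j) :: (p, q) :: L) = subperm ((i, q) :: (p, j) :: L).
Proof.
rewrite /subperm /=; case: ifP => // /andP[].
rewrite inE negb_or => /andP[ip iL] /andP[pL uL].
rewrite (reindex_inj (mulgI (tperm i p))) /=.
have tL r : r \in unzip1 L -> tperm i p r = r.
  by move=> rL; apply: tpermD; apply: contraTneq rL => <-.
apply: eq_big => [s | s _].
  rewrite !permM tpermL tpermR andbA [(_ == _) && (_ == _)]andbC -andbA.
  congr [&& _, _ & _]; apply: eq_in_all => e eL.
  by rewrite permM tL //; apply: map_f.
apply: eq_bigr => r; rewrite !inE !negb_or => /and3P[ri rp _].
by rewrite permM tpermD // eq_sym.
Qed.

Lemma subperm_matching L L' :
    perm_eq (unzip1 L) (unzip1 L') -> perm_eq (unzip2 L) (unzip2 L') ->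
  subperm L = subperm L'.
Proof.
pose r L L' := forall pre, subperm (pre ++ L) = subperm (pre ++ L').
move=> p1 p2; suff rLL : r L L' by apply: (rLL [::]).
apply: pairs_matching p1 p2.
- by [].
- by move=> L1 L2 h pre.
- by move=> L1 L2 L3 h h' pre; rewrite h.
- by move=> e L1 L2 h pre; rewrite -!cat_rcons h.
- move=> e e' L1 pre; apply: subperm_perm; rewrite perm_cat2l.
  exact: permEl (perm_catCA [:: e] [:: e'] L1).
move=> i j p q L1 pre.
have front e e' : perm_eq (pre ++ e :: e' :: L1) (e :: e' :: pre ++ L1).
  exact: permEl (perm_catCA pre [:: e; e'] L1).
by rewrite !(subperm_perm (front _ _)) subperm_exch.
Qed.

Lemma mderiv_prod (T : finType) (P : pred T) (F : T -> S) (x : 'I_(nsym n)) :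
  mderiv x (\prod_(i | P i) F i) =
  \sum_(i | P i) mderiv x (F i) * \prod_(j | P j && (j != i)) F j.
Proof.
have : uniq (index_enum T) := index_enum_uniq T.
elim: (index_enum T) => [_ | a r IH /= /andP[ar ur]].
  by rewrite !big_nil -mpolyC1 mderivC.
have others (i : T) : i \in r -> (a != i) = true.
  by move=> ir; apply: contraNneq ar => ->.
rewrite big_cons [RHS]big_cons; case: ifP => Pa; last first.
  rewrite IH // big_seq_cond [RHS]big_seq_cond; apply: eq_bigr => i /andP[ir _].
  by rewrite big_cons Pa.
rewrite mderivM IH // mulr_sumr big_cons eqxx andbF; congr (_ * _ + _).
  rewrite big_seq_cond [RHS]big_seq_cond; apply: eq_bigl => i.
  by case ir: (i \in r); rewrite //= eq_sym others // andbT.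
rewrite big_seq_cond [RHS]big_seq_cond; apply: eq_bigr => i /andP[ir _].
by rewrite big_cons Pa others //= mulrCA.
Qed.

Lemma symidx_eq i j p q :
  (symidx i j == symidx p q) = ((i, j) == (p, q)) || ((i, j) == (q, p)).
Proof.
apply/eqP/orP => [/enum_rank_inj/(congr1 val) /= | [] /eqP[-> ->] //];
  last by rewrite symidxC.
rewrite /sort_pair.
by case: (leqP i j); case: (leqP p q) => _ _ [-> ->]; rewrite !eqxx; auto.
Qed.

Lemma mderiv_var (x y : 'I_(nsym n)) :
  mderiv x ('X_y : S) = (y == x)%:R.
Proof.
rewrite mderivX mnm1E; have [-> | _] := eqVneq y x; last by rewrite scale0r.
rewrite scale1r -[RHS]mpolyX0; congr 'X_[_].
by apply/mnmP=> z; rewrite mnmBE subnn mnm0E.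
Qed.

(** The variable with index {p, q} sits at the positions (p, q) and (q, p), so
    differentiation deletes the row and the column of one of the two. For p = q
    the two positions coincide and the right-hand side counts the derivative
    twice. *)
Lemma mderiv_subperm p q L :
  mderiv (symidx p q) (subperm L) *+ (p == q).+1 =
  subperm ((p, q) :: L) + subperm ((q, p) :: L).
Proof.
have term i (s : 'S_n) :
  mderiv (symidx p q) (x_ i (s i)) *+ (p == q).+1 =
  ((i == p) && (s p == q))%:R + ((i == q) && (s q == p))%:R :> S.
  rewrite mderiv_var symidx_eq !xpair_eqE.
  have [<- | ip] /= := eqVneq i p; have [<- | iq] /= := eqVneq i q.
  - by rewrite orbb mulr2n.
  - by rewrite orbF addr0.
  - by rewrite (eq_sym p) (negPf ip) add0r.
  by rewrite mul0rn addr0.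
have pick_row i j : uniq (unzip1 L) ->
    \sum_(s : 'S_n | extends s L) \sum_(r | r \notin unzip1 L)
       ((r == i) && (s i == j))%:R *
       \prod_(t | (t \notin unzip1 L) && (t != r)) x_ t (s t) =
    subperm ((i, j) :: L).
  move=> uL; rewrite /subperm /= uL andbT; case: ifPn => [iL | ].
    rewrite big_andbC [RHS]big_mkcondr /=; apply: eq_bigr => s _.
    rewrite (bigD1 i) //= eqxx [X in _ + X]big1 ?addr0; last first.
      by move=> r /andP[_ /negPf ->]; rewrite mul0r.
    case: ifP => _; last by rewrite mul0r.
    by rewrite mul1r; apply: eq_bigl => t; rewrite inE negb_or andbC.
  rewrite negbK => iL; rewrite big1 // => s _; rewrite big1 // => r rL.
  have [ri | _] := eqVneq r i; last by rewrite mul0r.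
  by rewrite ri iL in rL.
have [uL | nuL] := boolP (uniq (unzip1 L)); last first.
  by rewrite /subperm /= (negPf nuL) !andbF mderiv0 mul0rn addr0.
rewrite -!pick_row // {1}/subperm uL raddf_sum -sumrMnl -big_split.
apply: eq_bigr => s _ /=; rewrite mderiv_prod -sumrMnl -big_split.
by apply: eq_bigr => i _ /=; rewrite -mulrnAl term mulrDl.
Qed.

(** A nonempty product of entries has no constant term, so the constant term is
    1 if all rows and columns have been deleted and 0 otherwise. *)
Lemma subperm_coef0 L :
  (subperm L)@_0 =
  (perm_eq (unzip1 L) (enum 'I_n) && perm_eq (unzip2 L) (enum 'I_n))%:R.
Proof.
have enumP (t : seq 'I_n) :
    uniq t -> perm_eq t (enum 'I_n) = [forall i, i \in t].
  move=> ut; apply/idP/forallP => [pt i | tT].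
    by rewrite (perm_mem pt) mem_enum.
  by apply: uniq_perm; rewrite ?enum_uniq // => i; rewrite tT mem_enum.
have [/andP[p1 p2] | not_full] := boolP (_ && _).
  pose diag := [seq (i, i) | i <- enum 'I_n].
  have d1 : unzip1 diag = enum 'I_n by rewrite /unzip1 -map_comp map_id.
  have d2 : unzip2 diag = enum 'I_n by rewrite /unzip2 -map_comp map_id.
  rewrite (@subperm_matching L diag) ?d1 ?d2 //.
  rewrite /subperm d1 enum_uniq (big_pred1 1%g) => [|s /=].
    by rewrite big_pred0 ?mcoeff1 ?eqxx // => i; rewrite mem_enum.
  rewrite /extends all_map; apply/allP/eqP => [s1 | -> i _ /=]; last first.
    by rewrite perm1.
  by apply/permP=> i; rewrite perm1; apply/eqP/s1; rewrite mem_enum.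
rewrite /subperm; case: ifP => [u1|]; last by rewrite mcoeff0.
rewrite raddf_sum big1 // => s ext_s.
have [full1 | /forallPn[i iL]] := boolP [forall i, i \in unzip1 L].
  case/negP: not_full; rewrite (extends_unzip2 ext_s).
  have s_inj := @perm_inj _ s; rewrite !enumP ?(map_inj_uniq s_inj) // full1 /=.
  apply/forallP=> i; rewrite -(permKV s i) mem_map //.
  exact: (forallP full1).
rewrite (bigD1 i) //= (rmorphM (mcoeff 0%MM)) /=.
by rewrite mcoeffX mnm1_eq0 mul0r.
Qed.

End SubPermanents.

(** * Linear extension and the action by differentiation *)

Section LinearExtension.

Variables (N : nat) (k : fieldType) (V : lmodType k) (Phi : 'X_{1..N} -> V).
Implicit Types f g : {mpoly k[N]}.

Definition linext f : V := \sum_(m <- msupp f) f@_m *: Phi m.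

Lemma linextE (s : seq 'X_{1..N}) f :
  uniq s -> {subset msupp f <= s} -> linext f = \sum_(m <- s) f@_m *: Phi m.
Proof.
move=> us sub; rewrite /linext [RHS](bigID (fun m => m \in msupp f)) /=.
rewrite [X in _ = _ + X]big1 ?addr0; last first.
  by move=> m /memN_msupp_eq0 ->; rewrite scale0r.
rewrite -[in RHS]big_filter; apply: perm_big.
apply: uniq_perm; rewrite ?msupp_uniq ?filter_uniq // => m.
by rewrite mem_filter; apply/idP/andP => [mf | []]; first by rewrite sub.
Qed.

Lemma linext_is_linear : linear linext.
Proof.
move=> c f g; pose s := undup (msupp f ++ msupp g ++ msupp (c *: f + g)).
have us : uniq s by apply: undup_uniq.
do 3![rewrite (@linextE s) //;
  last by move=> m; rewrite mem_undup !mem_cat => ->; rewrite ?orbT].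
rewrite scaler_sumr -big_split; apply: eq_bigr => m _ /=.
by rewrite mcoeffD mcoeffZ scalerDl scalerA.
Qed.

HB.instance Definition _ :=
  GRing.isLinear.Build k {mpoly k[N]} V _ linext linext_is_linear.

Lemma linextX m : linext 'X_[m] = Phi m.
Proof. by rewrite /linext msuppX big_seq1 mcoeffX eqxx scale1r. Qed.

End LinearExtension.

Lemma mpoly_mulX_ind (N : nat) (k : fieldType) (K : {mpoly k[N]} -> Prop) :
    K 1 -> (forall c f, K f -> K (c *: f)) ->
    (forall f g, K f -> K g -> K (f + g)) ->
    (forall i f, K f -> K ('X_i * f)) ->
  forall f, K f.
Proof.
move=> K1 KZ KD KX f.
have K0 : K 0 by rewrite -(scale0r 1); apply: KZ.
have KXm m : K 'X_[m].
  rewrite mpolyXE_id -[\prod_(i < N) _]mulr1.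
  apply: (big_rec (fun g => forall h, K h -> K (g * h))) (K1).
    by move=> h; rewrite mul1r.
  move=> i g _ IH h Kh.
  rewrite -mulrA; elim: (m i) => [|d IHd]; first by rewrite mul1r; apply: IH.
  by rewrite exprS -mulrA; apply: KX.
rewrite (mpolyE f); elim: (msupp f) => [|m s IH]; first by rewrite big_nil.
by rewrite big_cons; apply: KD => //; apply/KZ/KXm.
Qed.

Section ApplyDiff.

Variables (n : nat) (k : fieldType).
Implicit Types (c : k) (g h : polyS n k) (F G : polyR n k) (x : 'I_(nsym n)).

Lemma apply_diffE h F : apply_diff h F = linext (fun m => mderivm m F) h.
Proof. by []. Qed.

Lemma apply_diffD g h F :
  apply_diff (g + h) F = apply_diff g F + apply_diff h F.
Proof. by rewrite !apply_diffE linearD. Qed.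

Lemma apply_diffZ c h F : apply_diff (c *: h) F = c *: apply_diff h F.
Proof. by rewrite !apply_diffE linearZ. Qed.

Lemma apply_diff1 F : apply_diff 1 F = F.
Proof. by rewrite apply_diffE -mpolyX0 linextX mderivm0m. Qed.

Lemma apply_diff_Xl x h F : apply_diff ('X_x * h) F = mderiv x (apply_diff h F).
Proof.
rewrite (mpolyE h) mulr_sumr !apply_diffE.
rewrite !(raddf_sum (linext (fun m => mderivm m F))) raddf_sum.
apply: eq_bigr => m _ /=; rewrite -scalerAr !linearZ /= -mpolyXD !linextX.
by rewrite addmC mderivmDm mderivmU1m.
Qed.

Lemma apply_diff_Xr x h F : apply_diff ('X_x * h) F = apply_diff h (mderiv x F).
Proof.
rewrite (mpolyE h) mulr_sumr !apply_diffE.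
rewrite (raddf_sum (linext (fun m => mderivm m F))).
rewrite (raddf_sum (linext (fun m => mderivm m (mderiv x F)))).
apply: eq_bigr => m _ /=.
by rewrite -scalerAr !linearZ /= -mpolyXD !linextX mderivmDm mderivmU1m.
Qed.

Lemma apply_diffM g h F : apply_diff (g * h) F = apply_diff g (apply_diff h F).
Proof.
elim/mpoly_mulX_ind: g => [|c g IH|g g' IH IH'|x g IH].
- by rewrite mul1r apply_diff1.
- by rewrite -scalerAl !apply_diffZ IH.
- by rewrite mulrDl !apply_diffD IH IH'.
by rewrite -mulrA !apply_diff_Xl IH.
Qed.

Lemma apply_diff0r h : apply_diff h (0 : polyR n k) = 0.
Proof. by rewrite /apply_diff big1 // => m _; rewrite raddf0 scaler0. Qed.

Lemma apply_diffDr h F G :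
  apply_diff h (F + G) = apply_diff h F + apply_diff h G.
Proof.
rewrite /apply_diff -big_split; apply: eq_bigr => m _ /=.
by rewrite raddfD scalerDr.
Qed.

End ApplyDiff.

(** * Evaluation in the hyperbolic plane *)

Section Permanent.

Variables (n : nat) (k : fieldType).
Hypothesis two_neq0 : 2%:R != 0 :> k.

Local Notation pair := ('I_n * 'I_n)%type.
Local Notation S := {mpoly k[nsym n]}.
Local Notation D := {mpoly k[n + n]}.
Local Notation U := (@sym_form n k).
Implicit Types (i j p q : 'I_n) (e : pair) (L : seq pair) (m : 'X_{1..n + n}).

Definition rowvar i : D := 'X_(lshift n i).
Definition colvar i : D := 'X_(rshift n i).

Definition ends (x : 'I_(nsym n)) : pair := val (enum_val x).

Definition frame_var (x : 'I_(nsym n)) : D :=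
  let: (i, j) := ends x in
  if i == j then rowvar i * colvar i
  else rowvar i * colvar j + rowvar j * colvar i.

Definition frame_eval : {rmorphism S -> D} :=
  mmap (@mpolyC (n + n) k) frame_var.

Lemma symidx_ends x : symidx (ends x).1 (ends x).2 = x.
Proof.
rewrite /symidx /ends -[RHS]enum_valK; congr enum_rank; apply: val_inj => /=.
by rewrite /sort_pair (valP (enum_val x)) -surjective_pairing.
Qed.

Lemma ends_symidx i j : ends (symidx i j) = sort_pair i j.
Proof. by rewrite /ends enum_rankK. Qed.

Lemma frame_evalX (x : 'I_(nsym n)) : frame_eval 'X_x = frame_var x.
Proof. exact: etrans (mmapX _ _ _) (mmap1U _ _). Qed.

Lemma frame_eval_sym_form i j :
  frame_eval (U i j) = rowvar i * colvar j + rowvar j * colvar i.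
Proof.
rewrite /sym_form /yvar; have [-> | ij] := eqVneq i j.
  rewrite rmorphD /= frame_evalX /frame_var ends_symidx /sort_pair leqnn.
  by rewrite eqxx.
rewrite frame_evalX /frame_var ends_symidx /sort_pair; case: leqP => _.
  by rewrite (negPf ij).
by rewrite eq_sym (negPf ij) addrC.
Qed.

Lemma frame_evalZ c h : frame_eval (c *: h) = c *: frame_eval h.
Proof. exact: etrans (mmapZ _ _ _ _) (mul_mpolyC _ _). Qed.

Lemma sym_formX x : exists c : k, 'X_x = c *: U (ends x).1 (ends x).2.
Proof.
rewrite /sym_form /yvar; case: eqVneq => [e12 | _]; last first.
  by exists 1; rewrite scale1r symidx_ends.
exists 2%:R^-1; rewrite -mulr2n -scaler_nat scalerA mulVf // scale1r.
by rewrite [in X in symidx _ X]e12 symidx_ends.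
Qed.

Definition frame_mon L : D := \prod_(e <- L) (rowvar e.1 * colvar e.2).

Definition frame_mnm L : 'X_{1..n + n} :=
  (\sum_(e <- L) (U_(lshift n e.1) + U_(rshift n e.2)))%MM.

Lemma frame_monE L : frame_mon L = 'X_[frame_mnm L].
Proof.
rewrite /frame_mon /frame_mnm; elim: L => [|e L IH].
  by rewrite !big_nil mpolyX0.
by rewrite !big_cons IH !mpolyXD.
Qed.

Lemma frame_mnm_row L i : frame_mnm L (lshift n i) = count_mem i (unzip1 L).
Proof.
rewrite /frame_mnm mnm_sumE; elim: L => [|e L IH]; first by rewrite big_nil.
rewrite big_cons IH mnmDE !mnm1E /= (inj_eq (@lshift_inj _ _)).
by rewrite eq_rlshift addn0.
Qed.

Lemma frame_mnm_col L j : frame_mnm L (rshift n j) = count_mem j (unzip2 L).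
Proof.
rewrite /frame_mnm mnm_sumE; elim: L => [|e L IH]; first by rewrite big_nil.
rewrite big_cons IH mnmDE !mnm1E /= (inj_eq (@rshift_inj _ _)).
by rewrite eq_lrshift add0n.
Qed.

Definition mseq (f : 'I_n -> nat) : seq 'I_n :=
  flatten [seq nseq (f i) i | i <- enum 'I_n].

Lemma count_mseq f i : count_mem i (mseq f) = f i.
Proof.
rewrite /mseq count_flatten -map_comp sumnE big_map big_enum /= (bigD1 i) //=.
rewrite count_nseq /= eqxx mul1n big1 ?addn0 // => j ji.
by rewrite count_nseq /= (negPf ji).
Qed.

Definition mnm_rows m := mseq (fun i => m (lshift n i)).
Definition mnm_cols m := mseq (fun i => m (rshift n i)).
(** Only monomials with as many a's as b's come from lists of pairs; the linear
    maps defined from lists are 0 on the others. *)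
Definition balanced m := size (mnm_rows m) == size (mnm_cols m).
Definition mnm_pairs m := zip (mnm_rows m) (mnm_cols m).

Lemma perm_mseq f (s : seq 'I_n) :
  (forall i, count_mem i s = f i) -> perm_eq (mseq f) s.
Proof. by move=> sf; apply/allP=> i _ /=; rewrite count_mseq sf. Qed.

Lemma mnm_rows_frame L : perm_eq (mnm_rows (frame_mnm L)) (unzip1 L).
Proof. by apply: perm_mseq => i; rewrite frame_mnm_row. Qed.

Lemma mnm_cols_frame L : perm_eq (mnm_cols (frame_mnm L)) (unzip2 L).
Proof. by apply: perm_mseq => i; rewrite frame_mnm_col. Qed.

Lemma balanced_frame_mnm L : balanced (frame_mnm L).
Proof.
rewrite /balanced (perm_size (mnm_rows_frame L)).
by rewrite (perm_size (mnm_cols_frame L)) !size_map.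
Qed.

Lemma unzip1_mnm_pairs m : balanced m -> unzip1 (mnm_pairs m) = mnm_rows m.
Proof. by move/eqP=> sz; rewrite /mnm_pairs unzip1_zip ?sz. Qed.

Lemma unzip2_mnm_pairs m : balanced m -> unzip2 (mnm_pairs m) = mnm_cols m.
Proof. by move/eqP=> sz; rewrite /mnm_pairs unzip2_zip ?sz. Qed.

Lemma mnm_pairsK m : balanced m -> frame_mnm (mnm_pairs m) = m.
Proof.
move=> bm; apply/mnmP=> x; rewrite -(splitK x); case: (split x) => i /=.
  by rewrite frame_mnm_row unzip1_mnm_pairs // count_mseq.
by rewrite frame_mnm_col unzip2_mnm_pairs // count_mseq.
Qed.

Lemma mnm_pairs_nuniq m x : balanced m -> (1 < m x)%N ->
  ~~ uniq (unzip1 (mnm_pairs m)) \/ ~~ uniq (unzip2 (mnm_pairs m)).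
Proof.
move=> bm; rewrite -(splitK x); case: (split x) => i /= mi; [left | right].
  rewrite unzip1_mnm_pairs //; apply/negP=> /(count_uniq_mem i).
  by rewrite count_mseq => mE; move: mi; rewrite mE; case: (_ \in _).
rewrite unzip2_mnm_pairs //; apply/negP=> /(count_uniq_mem i).
by rewrite count_mseq => mE; move: mi; rewrite mE; case: (_ \in _).
Qed.

Section PairExtension.

Variables (V : lmodType k) (F : seq pair -> V).

Definition pair_ext : D -> V :=
  linext (fun m => if balanced m then F (mnm_pairs m) else 0).

HB.instance Definition _ := GRing.Linear.on pair_ext.

Lemma pair_extX m :
  pair_ext 'X_[m] = if balanced m then F (mnm_pairs m) else 0.
Proof. exact: linextX. Qed.

Lemma pair_ext_mon L : pair_ext (frame_mon L) = F (mnm_pairs (frame_mnm L)).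
Proof. by rewrite frame_monE pair_extX balanced_frame_mnm. Qed.

End PairExtension.

Lemma unzip1_pairs_frame L :
  perm_eq (unzip1 (mnm_pairs (frame_mnm L))) (unzip1 L).
Proof.
by rewrite unzip1_mnm_pairs ?balanced_frame_mnm // mnm_rows_frame.
Qed.

Lemma unzip2_pairs_frame L :
  perm_eq (unzip2 (mnm_pairs (frame_mnm L))) (unzip2 L).
Proof.
by rewrite unzip2_mnm_pairs ?balanced_frame_mnm // mnm_cols_frame.
Qed.

(** Multiplying h by a variable replaces the list of oriented pairs by the two
    lists in which the new pair has been added in either orientation. The
    permanents of submatrices and the normal forms below obey the same rule. *)
Lemma frame_evalX_mon x : exists2 c : k,
  'X_x = c *: U (ends x).1 (ends x).2 &
  forall h L, frame_eval ('X_x * h) * frame_mon L =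
    c *: (frame_eval h * frame_mon (ends x :: L)
          + frame_eval h * frame_mon (flip (ends x) :: L)).
Proof.
have [c xE] := sym_formX x; exists c => // h L.
rewrite rmorphM /= xE frame_evalZ frame_eval_sym_form -scalerAl -scalerAl.
by congr (_ *: _); rewrite /frame_mon !big_cons /=; ring.
Qed.

(** * Lifting back modulo the ideal *)

Local Notation I := (ideal_gen (fun g => Qprime g \/ @cubics n k g)).
Local Notation inv2 := (inv2 n k).

(** The factor normalises u_e + v_e = 2 a_i b_j, so that the image of
    [normal_form L] is the mean of the monomial of L and of its mirror image. *)
Definition normal_form L : S := inv2 ^+ size L * even_part U L.

Definition frame_lift : D -> S := pair_ext normal_form.
HB.instance Definition _ := GRing.Linear.on frame_lift.

Let I_0 := @ideal_gen0 _ (fun g => Qprime g \/ @cubics n k g).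
Let I_D := @ideal_genD _ (fun g => Qprime g \/ @cubics n k g).
Let I_M := @ideal_genM _ (fun g => Qprime g \/ @cubics n k g).

Let even_part_matching := @even_part_matching _ _ _ I_0 I_D I_M _
  (@sym_formC n k) (@ideal_minor3 n k two_neq0).
Let even_part_nuniq1 := @even_part_nuniq1 _ _ _ I_0 I_D I_M _ _
  (@inv2E n k two_neq0) (@sym_formC n k) (@ideal_minor3 n k two_neq0)
  (@sym_form_half n k two_neq0).
Let even_part_nuniq2 := @even_part_nuniq2 _ _ _ I_0 I_D I_M _ _
  (@inv2E n k two_neq0) (@sym_formC n k) (@ideal_minor3 n k two_neq0)
  (@sym_form_half n k two_neq0).

Lemma ideal_scale c x : I x -> I (c *: x).
Proof. by rewrite -mul_mpolyC; apply: ideal_genM. Qed.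

(** The statement is proved for all L at once because multiplying h by a
    variable lengthens L. *)
Lemma frame_lift_eval h L :
  I (frame_lift (frame_eval h * frame_mon L) - h * normal_form L).
Proof.
move: h L; apply: mpoly_mulX_ind => [L | c h IH L | g h IHg IHh L | x h IH L].
- rewrite rmorph1 !mul1r /frame_lift pair_ext_mon /normal_form.
  have p1 := unzip1_pairs_frame L; have p2 := unzip2_pairs_frame L.
  have := perm_size p1; rewrite !size_map => ->; rewrite -mulrBr.
  exact/ideal_genM/even_part_matching.
- rewrite frame_evalZ -scalerAl linearZ /= -scalerAl -scalerBr.
  exact/ideal_scale/IH.
- rewrite rmorphD !mulrDl linearD /= opprD addrACA.
  exact: ideal_genD (IHg L) (IHh L).
have [c xE ->] := frame_evalX_mon x.
set e := ends x in xE *.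
have eE : U e.1 e.2 * normal_form L =
    normal_form (e :: L) + normal_form (flip e :: L).
  rewrite /normal_form /= !exprS -mulrDr even_partDflip; last exact: sym_formC.
  by rewrite -[LHS]mul1r -(@inv2E n k two_neq0); ring.
rewrite linearZ linearD /= xE -2!scalerAl -scalerBr; apply: ideal_scale.
rewrite (mulrC _ h) -mulrA eE mulrDr opprD addrACA.
exact: ideal_genD (IH (e :: L)) (IH (flip e :: L)).
Qed.

(** * The annihilator of the permanent *)

Definition frame_subperm : D -> S := pair_ext (@subperm n k).

HB.instance Definition _ := GRing.Linear.on frame_subperm.

Lemma frame_subperm_mon L : frame_subperm (frame_mon L) = subperm k L.
Proof.
rewrite /frame_subperm pair_ext_mon; apply: subperm_matching.
  exact: unzip1_pairs_frame.
exact: unzip2_pairs_frame.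
Qed.

(** Induction on h for all L at once: by [mderiv_subperm], differentiating by
    one more variable prolongs L in the two ways of [frame_evalX_mon]. *)
Lemma apply_diff_subperm h L :
  apply_diff h (subperm k L) = frame_subperm (frame_eval h * frame_mon L).
Proof.
move: h L; apply: mpoly_mulX_ind => [L | c h IH L | g h IHg IHh L | x h IH L].
- by rewrite apply_diff1 rmorph1 mul1r frame_subperm_mon.
- by rewrite apply_diffZ IH frame_evalZ -scalerAl linearZ.
- by rewrite apply_diffD IHg IHh rmorphD mulrDl linearD.
have [c xE ->] := frame_evalX_mon x.
rewrite linearZ linearD /= -!IH xE -scalerAl apply_diffZ -apply_diffDr.
congr (_ *: _); rewrite [flip _]/flip.
have := mderiv_subperm k (ends x).1 (ends x).2 L.
rewrite -surjective_pairing => <-.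
rewrite /sym_form; case: eqVneq => [e12 | _] /=; last by rewrite apply_diff_Xr.
by rewrite mulrDl apply_diffD !apply_diff_Xr -apply_diffDr mulr2n e12.
Qed.

Lemma apply_diff_perm h :
  apply_diff h (permanent (generic_sym n k)) = frame_subperm (frame_eval h).
Proof.
by rewrite -subperm_nil apply_diff_subperm /frame_mon big_nil mulr1.
Qed.

Definition full_mnm : 'X_{1..n + n} := [multinom 1%N | _ < n + n].

Lemma full_mnmE L :
  (frame_mnm L == full_mnm) =
  perm_eq (unzip1 L) (enum 'I_n) && perm_eq (unzip2 L) (enum 'I_n).
Proof.
have count1 i : count_mem i (enum 'I_n) = 1%N.
  by rewrite (count_uniq_mem _ (enum_uniq _)) mem_enum.
apply/eqP/andP => [LE | [/seq.permP p1 /seq.permP p2]].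
  split; apply/allP=> i _ /=.
    by rewrite -frame_mnm_row LE mnmE count1.
  by rewrite -frame_mnm_col LE mnmE count1.
apply/mnmP=> x; rewrite mnmE -(splitK x); case: (split x) => i /=.
  by rewrite frame_mnm_row p1 count1.
by rewrite frame_mnm_col p2 count1.
Qed.

Lemma balanced_full_mnm : balanced full_mnm.
Proof.
rewrite /balanced; apply/eqP/perm_size/perm_mseq => i.
by rewrite count_mseq !mnmE.
Qed.

Lemma frame_subperm_coef0 f : (frame_subperm f)@_0 = f@_full_mnm.
Proof.
rewrite [in LHS](mpolyE f) [in RHS](mpolyE f).
rewrite (raddf_sum frame_subperm) !raddf_sum.
apply: eq_bigr => m _ /=.
rewrite linearZ /= !mcoeffZ mcoeffX /frame_subperm pair_extX; congr (_ * _).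
case: ifP => [bm | nbm]; last first.
  by rewrite mcoeff0; case: eqP => // mE; rewrite mE balanced_full_mnm in nbm.
by rewrite subperm_coef0 -full_mnmE mnm_pairsK.
Qed.

(** The substitution is invariant under exchanging the a's and the b's, which
    fixes the monomial [full_mnm]. *)
Lemma frame_eval_flip h L :
  (frame_eval h * frame_mon L)@_full_mnm =
  (frame_eval h * frame_mon (map flip L))@_full_mnm.
Proof.
move: h L; apply: mpoly_mulX_ind => [L | c h IH L | g h IHg IHh L | x h IH L].
- rewrite rmorph1 !mul1r !frame_monE !mcoeffX !full_mnmE.
  by rewrite /unzip1 /unzip2 -!map_comp andbC.
- by rewrite frame_evalZ -!scalerAl !mcoeffZ IH.
- by rewrite rmorphD !mulrDl !mcoeffD IHg IHh.
have [c _ evalE] := frame_evalX_mon x.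
rewrite !evalE !mcoeffZ !mcoeffD 2!IH /= addrC; congr (_ * (_ + _)).
by rewrite /flip /=; case: (ends x).
Qed.

(** By u_e + v_e = 2 a_i b_j and u_e - v_e = 2 a_j b_i, the even and the odd
    part are half the sum and half the difference of two products of monomials. *)
Lemma frame_eval_even_odd L :
  2%:R * frame_eval (even_part U L) =
    2%:R ^+ size L * (frame_mon L + frame_mon (map flip L)) /\
  forall e, 2%:R * frame_eval (odd_part U L e) =
    2%:R ^+ size L * (frame_mon L - frame_mon (map flip L)) *
    (rowvar e.1 * colvar e.2 - rowvar e.2 * colvar e.1).
Proof.
elim: L => [|e L [IHe IHo]].
  rewrite /frame_mon !big_nil rmorph1; split=> [|e]; first by ring.
  by rewrite /odd_part /= rmorph0; ring.
have monS x M : frame_mon (x :: M) = rowvar x.1 * colvar x.2 * frame_mon M.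
  by rewrite /frame_mon big_cons.
have evS : frame_eval (even_part U (e :: L)) =
    frame_eval (U e.1 e.2) * frame_eval (even_part U L)
    + frame_eval (odd_part U L e).
  by rewrite -rmorphM -rmorphD.
have odS f : frame_eval (odd_part U (e :: L) f) =
    frame_eval (U e.1 e.2) * frame_eval (odd_part U L f)
    + frame_eval (gram U e f) * frame_eval (even_part U L).
  by rewrite -!rmorphM -rmorphD.
have dist2 (a b c d : D) :
    2%:R * (a * b + c * d) = a * (2%:R * b) + c * (2%:R * d) by ring.
have dist1 (a b c : D) : 2%:R * (a * b + c) = a * (2%:R * b) + 2%:R * c by ring.
split=> [|f].
  rewrite evS dist1 IHe IHo frame_eval_sym_form !monS exprS /flip /=.
  by ring.
have eval_gram : frame_eval (gram U e f) =
    frame_eval (U e.1 f.2) * frame_eval (U e.2 f.1)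
    - frame_eval (U e.1 f.1) * frame_eval (U e.2 f.2).
  by rewrite -!rmorphM -rmorphB.
rewrite odS dist2 IHo IHe eval_gram !frame_eval_sym_form !monS exprS /flip /=.
by ring.
Qed.

Lemma size_mseq f : size (mseq f) = (\sum_i f i)%N.
Proof.
rewrite /mseq size_flatten /shape -map_comp sumnE big_map big_enum.
by apply: eq_bigr => i _ /=; rewrite size_nseq.
Qed.

(** The product of [even_part U L] and h annihilates the permanent too, and by
    [frame_eval_even_odd] and [frame_eval_flip] the constant term of the result
    is the left-hand side up to a power of 2. *)
Lemma Ann_pairing h L :
  Ann (permanent (generic_sym n k)) h ->
  (frame_eval h * frame_mon L)@_full_mnm = 0.
Proof.
rewrite /Ann => hF0.
have := apply_diffM (even_part U L) h (permanent (generic_sym n k)).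
rewrite hF0 apply_diff0r apply_diff_perm rmorphM => /(congr1 (mcoeff 0%MM)).
rewrite frame_subperm_coef0 mcoeff0 => /(congr1 ( *%R 2%:R)).
rewrite mulr0 -mcoeffCM mpolyC_nat mulrA (proj1 (frame_eval_even_odd L)).
have -> : 2%:R ^+ size L = (2%:R ^+ size L)%:MP :> D.
  by rewrite rmorphXn /= mpolyC_nat.
rewrite -mulrA mcoeffCM mulrDl mcoeffD ![_ * frame_eval h]mulrC.
rewrite -frame_eval_flip.
have -> (a : k) : a + a = 2%:R * a by ring.
rewrite mulrA => /eqP.
by rewrite mulf_eq0 -exprSr expf_eq0 (negPf two_neq0) andbF => /eqP.
Qed.

(** Pair with the complementary monomial. *)
Lemma Ann_squarefree h m : Ann (permanent (generic_sym n k)) h ->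
  balanced m -> (forall x, (m x <= 1)%N) -> (frame_eval h)@_m = 0.
Proof.
move=> hF0 bm m1; pose m' := (full_mnm - m)%MM.
have m'm : (m' + m)%MM = full_mnm.
  by apply/mnmP=> x; rewrite mnmDE mnmBE subnK // mnmE.
have bm' : balanced m'.
  have side (g : 'I_n -> 'I_(n + n)) :
      (\sum_i m' (g i) + \sum_i m (g i) = n)%N.
    rewrite -big_split /= -[RHS](card_ord n) -sum1_card; apply: eq_bigr => i _.
    by rewrite -mnmDE m'm mnmE.
  move: bm; rewrite /balanced !size_mseq => /eqP bm.
  have /eqP := etrans (side (@lshift n n)) (esym (side (@rshift n n))).
  by rewrite bm eqn_add2r.
by rewrite -(mcoeffMX _ m') m'm -(mnm_pairsK bm') -frame_monE Ann_pairing.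
Qed.

Lemma normal_form_nuniq m x : balanced m -> (1 < m x)%N ->
  I (normal_form (mnm_pairs m)).
Proof.
move=> bm mx; apply: ideal_genM.
by case: (mnm_pairs_nuniq bm mx) => [/even_part_nuniq1 | /even_part_nuniq2].
Qed.

Lemma Ann_in_ideal h : Ann (permanent (generic_sym n k)) h -> I h.
Proof.
move=> hF0; have := frame_lift_eval h [::].
rewrite /frame_mon big_nil /normal_form expr0 !mulr1 => liftE.
suff lift0 : I (frame_lift (frame_eval h)).
  by apply: ideal_gen_eq (ideal_genD lift0 (ideal_genM (- 1) liftE)); ring.
rewrite /frame_lift /pair_ext /linext; apply: big_ind => [||m _].
- exact: ideal_gen0.
- by move=> x y; apply: ideal_genD.
case: ifP => bm; last by rewrite scaler0; apply: ideal_gen0.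
have [/forallP m1 | /forallPn[x]] := boolP [forall x, m x <= 1]%N.
  by rewrite Ann_squarefree // scale0r; apply: ideal_gen0.
by rewrite -ltnNge => mx; apply/ideal_scale/(normal_form_nuniq bm mx).
Qed.

Lemma frame_subperm_square (x : 'I_(n + n)) f :
  frame_subperm ('X_x * 'X_x * f) = 0.
Proof.
rewrite (mpolyE f) mulr_sumr (raddf_sum frame_subperm) big1 // => m _ /=.
rewrite -scalerAr linearZ /= -!mpolyXD /frame_subperm pair_extX.
case: ifP => bm; last by rewrite scaler0.
have mx : (1 < (U_(x) + U_(x) + m)%MM x)%N by rewrite !mnmDE mnm1E eqxx.
case: (mnm_pairs_nuniq bm mx) => [nu | /subperm_nuniq2 ->]; last first.
  by rewrite scaler0.
by rewrite /subperm (negPf nu) scaler0.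
Qed.

Lemma frame_eval_yvar_neq i j :
  i != j -> frame_eval (yvar k i j) = rowvar i * colvar j + rowvar j * colvar i.
Proof. by move=> ij; rewrite -frame_eval_sym_form /sym_form (negPf ij). Qed.

Lemma frame_eval_yvar_diag i : frame_eval (yvar k i i) = rowvar i * colvar i.
Proof.
by rewrite /yvar frame_evalX /frame_var ends_symidx /sort_pair leqnn eqxx.
Qed.

Lemma frame_subperm_squares i a b f :
  frame_subperm ((rowvar i * rowvar i * a + colvar i * colvar i * b) * f) = 0.
Proof.
rewrite mulrDl linearD /= -!mulrA !(mulrA _ _ (_ * f)).
by rewrite !frame_subperm_square addr0.
Qed.

(** Each quadratic generator maps to a combination of a_i^2 and b_i^2. *)
Lemma frame_subperm_Qprime g f :
  Qprime g -> frame_subperm (frame_eval g * f) = 0.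
Proof.
case=> [i j | i j ij | i j l ij il jl].
- have [<- | ij] := eqVneq i j.
    rewrite rmorphM /= frame_eval_yvar_diag.
    rewrite -[RHS](frame_subperm_squares i (colvar i * colvar i) 0 f).
    by congr frame_subperm; ring.
  rewrite rmorphM /= frame_eval_yvar_diag frame_eval_yvar_neq //.
  rewrite -[RHS](frame_subperm_squares i (colvar i * colvar j)
                                         (rowvar i * rowvar j) f).
  by congr frame_subperm; ring.
- rewrite rmorphB rmorphXn rmorphM rmorph_nat rmorphM /= !frame_eval_yvar_diag.
  rewrite frame_eval_yvar_neq //.
  rewrite -[RHS](frame_subperm_squares i (colvar j * colvar j)
                                         (rowvar j * rowvar j) f).
  by congr frame_subperm; ring.
rewrite rmorphB !rmorphM /= frame_eval_yvar_diag.
rewrite !frame_eval_yvar_neq // 1?eq_sym //.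
rewrite -[RHS](frame_subperm_squares i (colvar j * colvar l)
                                       (rowvar j * rowvar l) f).
by congr frame_subperm; ring.
Qed.

Lemma frame_eval_cubics g : cubics g -> frame_eval g = 0.
Proof.
case=> t t_incr.
pose z a b := yvar k (t (inord a.-1)) (t (inord b.-1)).
pose r a := rowvar (t (inord a.-1)); pose c a := colvar (t (inord a.-1)).
have eval_z a b : [&& 0 < a, a < b & b <= 6]%N ->
    frame_eval (z a b) = r a * c b + r b * c a.
  case/and3P=> a0 ab b6; apply: frame_eval_yvar_neq; rewrite neq_ltn t_incr //.
  by rewrite !inordK; lia.
have [F1 F2 F3 F4 F5] := cubics_vanish eval_z.
rewrite !inE => /or4P[/eqP -> | /eqP -> | /eqP -> | /orP[]/eqP ->].
- exact: F1.
- exact: F2.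
- exact: F3.
- exact: F4.
exact: F5.
Qed.

Lemma ideal_in_Ann h : I h -> Ann (permanent (generic_sym n k)) h.
Proof.
case=> s Gs ->; rewrite /Ann apply_diff_perm rmorph_sum.
rewrite (raddf_sum frame_subperm).
rewrite big_seq big1 // => u /Gs Gu /=.
rewrite rmorphM mulrC /=; case: Gu => [Qg | /frame_eval_cubics ->].
  exact: frame_subperm_Qprime.
by rewrite mul0r linear0.
Qed.

End Permanent.

Lemma yvar_homog n k i j : @yvar n k i j \is 1.-homog.
Proof. by rewrite /yvar dhomogX /= mdeg1. Qed.

Lemma Qprime_homog n k g : @Qprime n k g -> g \is 2.-homog.
Proof.
have h2 i j i' j' : @yvar n k i j * yvar k i' j' \is 2.-homog.
  by apply: (dhomogM (d := 1) (e := 1)); apply: yvar_homog.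
case=> *; rewrite ?rpredB // ?expr2 //.
by rewrite mulr_natl rpredMn.
Qed.

Lemma cubics_homog n k g : @cubics n k g -> g \is 3.-homog.
Proof.
have h3 i j i' j' i'' j'' :
    @yvar n k i j * yvar k i' j' * yvar k i'' j'' \is 3.-homog.
  apply: (dhomogM (d := 2) (e := 1)); last exact: yvar_homog.
  by apply: (dhomogM (d := 1) (e := 1)); apply: yvar_homog.
case=> t _; rewrite !inE => /or4P[/eqP -> | /eqP -> | /eqP -> | /orP[]/eqP ->];
  rewrite /cubicF1 /cubicF2 /cubicF3 /cubicF4 /cubicF5;
  by do ![exact: h3 | apply: rpredB | apply: rpredD].
Qed.

Theorem theorem3p23 (n : nat) (k : fieldType)
    (k_infinite : infinite_field k) (k_char : char_zero_or_gt2 k) :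
  (forall h : polyS n k,
     Ann (permanent (generic_sym n k)) h <-> Qprime_plus h) /\
  (forall h : polyS n k,
     Qprime_plus h <->
     ideal_gen (fun g : polyS n k => Qprime g \/ cubics g) h) /\
  (forall g : polyS n k, Qprime g -> g \is 2.-homog) /\
  (forall g : polyS n k, cubics g -> g \is 3.-homog).
Proof.
have two_neq0 := char_two_neq0 k_char.
have plusE h := ideal_addE (@Qprime n k) (@cubics n k) h.
split=> [h|]; first split=> [/(Ann_in_ideal two_neq0) Ih | /plusE Ih].
- exact/plusE.
- exact: ideal_in_Ann.
split=> [h|]; first exact: plusE.
by split=> g; [apply: Qprime_homog | apply: cubics_homog].
Qed.
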